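(* Let $R=\mathbb{K}[x_1,\ldots,x_d]$ be a polynomial ring over a field $\mathbb{K}$, and let $G$ be a finite group acting linearly on $R$ such that each element $g\in G$, $g\neq e$, fixes only the origin of $\mathbb{K}^d$. Let $I_G=\bigcap_{g\in G}(y_1-g(x_1),\ldots,y_d-g(x_d))\subseteq S=\mathbb{K}[x_1,\ldots,x_d,y_1,\ldots,y_d]$ be the Derksen ideal. Then $I_G^{(n)}S_{\mathfrak{p}}=I_G^nS_{\mathfrak{p}}$ for all $n\in\mathbb{N}$ and for all prime ideals $\mathfrak{p}$ of $S$ different from $(x_1,\ldots,x_d,y_1,\ldots,y_d)$.
   Context: A group $G$ acts linearly on $R=\mathbb{K}[x_1,\ldots,x_d]$ if it acts by ring automorphisms such that $g(a)=a$ for every $a\in\mathbb{K}$, $g\in G$, and $g(x_i)$ is a homogeneous linear polynomial (degree-one form) for every $i=1,\ldots,d$ and $g\in G$. The identity of $G$ is denoted $e$. Each $g\in G$ induces a linear map of $V=\mathbb{K}^d$, $u\mapsto g(u)=(g(x_1)(u),\ldots,g(x_d)(u))$; ''$g$ fixes only the origin'' means $\{u\in V: g(u)=u\}=\{0\}$. Symbolic powers: for an ideal $I\subseteq S$, the $n$-th symbolic power is $I^{(n)}=\bigcap_{\mathfrak{q}\in\mathrm{Ass}(S/I)}(I^nS_{\mathfrak{q}}\cap S)$, where $\mathrm{Ass}(S/I)$ is the set of associated primes of $I$ and $I^nS_{\mathfrak{q}}\cap S$ denotes the preimage of $I^nS_{\mathfrak{q}}$ under $S\to S_{\mathfrak{q}}$.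 *)

(* Defs.v *)
From HB Require Import structures.
From mathcomp Require Import all_boot all_order all_algebra all_fingroup.
From mathcomp Require Import boolp classical_sets.
From mathcomp Require Import mpoly.

Set Implicit Arguments.
Unset Strict Implicit.
Unset Printing Implicit Defensive.

Import GRing.Theory.

Local Open Scope classical_set_scope.
Local Open Scope ring_scope.

Section Ideals.
Variable A : comNzRingType.

(* For a subring B of A and a subset X of B, the ideal of B generated by X. *)
Definition subring_ideal_gen (B X : set A) : set A :=
  [set x | exists k (b a : 'I_k -> A),
     [/\ forall i, B (b i), forall i, X (a i) & x = \sum_(i < k) b i * a i]].

Definition ideal_gen (X : set A) : set A := subring_ideal_gen setT X.

(* I ^ n is generated by the n-fold products of elements of I; the empty
   product gives I ^ 0 = A. *)
Definition ideal_pow (I : set A) (n : nat) : set A :=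
  ideal_gen [set x | exists a : 'I_n -> A,
                       (forall i, I (a i)) /\ x = \prod_(i < n) a i].

(* idealr_closed already forces an ideal to be proper. *)
Definition prime_ideal (p : set A) : Prop :=
  idealr_closed (mem p) /\ prime_idealr_closed (mem p).

(* Ass(A/I): the prime ideals that are the annihilator of the class in A/I of
   some f in A. *)
Definition assoc_primes (I : set A) : set (set A) :=
  [set q | prime_ideal q /\ exists f, q = [set s | I (s * f)]].

End Ideals.

Section Localization.
Variable A : idomainType.

(* The localization of the domain A at a prime p, as a subring of its field of
   fractions. *)
Definition localization (p : set A) : set {fraction A} :=
  [set x | exists a s, ~ p s /\ x = tofrac a / tofrac s].

(* The extended ideal I A_p of A_p. *)
Definition loc_ideal (p I : set A) : set {fraction A} :=
  subring_ideal_gen (localization p) ((@tofrac A) @` I).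

Definition symbolic_pow (I : set A) (n : nat) : set A :=
  \bigcap_(q in assoc_primes I) ((@tofrac A) @^-1` loc_ideal q (ideal_pow I n)).

End Localization.

Section LinearAction.
Variables (K : fieldType) (d : nat) (G : finGroupType).
Variable act : G -> {rmorphism {mpoly K[d]} -> {mpoly K[d]}}.

(* A left action; each act g is bijective, with inverse act g^-1, by the first
   two axioms. *)
Record acts_linearly : Prop := ActsLinearly {
  act_one : forall f, act 1%g f = f;
  act_mul : forall (g h : G) f, act (g * h)%g f = act g (act h f);
  act_const : forall (g : G) (a : K), act g a%:MP = a%:MP;
  act_linear : forall (g : G) (i : 'I_d), act g 'X_i \is 1.-homog
}.

(* The map u |-> (g(x_1)(u), ..., g(x_d)(u)) induced by g on K^d. *)
Definition induced_map (g : G) (u : 'rV[K]_d) : 'rV[K]_d :=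
  \row_i (act g 'X_i).@[fun j => u 0 j].

Definition fixes_only_origin (g : G) : Prop :=
  [set u | induced_map g u = u] = [set 0].

(* S = K[x_1, ..., x_d, y_1, ..., y_d]: the first d variables are the x_i, the
   last d ones the y_i. *)
Definition xvar (i : 'I_d) : {mpoly K[d + d]} := 'X_(lshift d i).
Definition yvar (i : 'I_d) : {mpoly K[d + d]} := 'X_(rshift d i).

Definition embed (f : {mpoly K[d]}) : {mpoly K[d + d]} :=
  f \mPo [tuple xvar i | i < d].

Definition derksen_ideal : set {mpoly K[d + d]} :=
  \bigcap_(g : G) ideal_gen (range (fun i => yvar i - embed (act g 'X_i))).

Definition irrelevant_ideal : set {mpoly K[d + d]} :=
  ideal_gen (range xvar `|` range yvar).

End LinearAction.

Arguments irrelevant_ideal : clear implicits.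

(* Main.v *)
Require Import Defs.
From mathcomp Require Import all_boot all_order all_algebra all_fingroup.
From mathcomp Require Import boolp classical_sets.
From mathcomp Require Import mpoly.

(* Write I_G as the intersection of the ideals J_g = (y_i - g(x_i)) of the graphs
   of the g in G. For g <> h the map h - g = g(g^-1 h - 1) is invertible on linear
   forms, so J_g + J_h is the irrelevant ideal m; hence a prime p <> m, which
   cannot contain m, contains at most one J_g. If p contains none, some s in I_G
   avoids p and s^n lies in I_G^n. If p contains only J_g, some s outside p
   satisfies s J_g <= I_G, so J_g is associated to I_G and s^n J_g^n <= I_G^n; it
   remains to see that J_g^n is J_g-primary. For this, let Phi : S -> S[t]
   substitute g(x_i) + t (y_i - g(x_i)) for y_i: then J_g^n is the preimage of
   (t^n), and S[t] is a domain. *)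

Set Implicit Arguments.
Unset Strict Implicit.
Unset Printing Implicit Defensive.

Import GRing.Theory.

Local Open Scope classical_set_scope.
Local Open Scope ring_scope.

(** * Ideals, their powers, and primes *)

Section IdealPowers.
Variable A : comNzRingType.
Implicit Types (I J X p : set A) (n : nat).

(** Unlike [idealr_closed], this does not force properness, so it also covers $I^0 = A$ and
    intersections over an empty family. *)
Definition is_ideal I : Prop :=
  I 0 /\ forall a x y, I x -> I y -> I (a * x + y).

Lemma is_idealD I x y : is_ideal I -> I x -> I y -> I (x + y).
Proof. by case=> _ H Ix Iy; rewrite -[x]mul1r; apply: H. Qed.

Lemma is_idealMl I a x : is_ideal I -> I x -> I (a * x).
Proof. by case=> I0 H Ix; rewrite -[_ * _]addr0; apply: H. Qed.

Lemma is_idealB I x y : is_ideal I -> I x -> I y -> I (x - y).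
Proof. by move=> [_ H] Ix Iy; rewrite addrC -mulN1r; apply: H. Qed.

Lemma is_ideal_sum I T (r : seq T) (P : pred T) (F : T -> A) :
  is_ideal I -> (forall i, P i -> I (F i)) -> I (\sum_(i <- r | P i) F i).
Proof.
move=> HI HF; apply: (big_ind I) => //; first by case: HI.
by move=> x y; apply: is_idealD.
Qed.

Lemma is_ideal_gen X : is_ideal (ideal_gen X).
Proof.
split.
  by exists 0%N, (fun=> 0), (fun=> 0); split=> [[]//|[]//|]; rewrite big_ord0.
move=> c _ _ [k [b [a [_ Xa ->]]]] [l [b' [a' [_ Xa' ->]]]].
exists (k + l)%N, (fun i => match split i with inl j => c * b j | inr j => b' j end),
  (fun i => match split i with inl j => a j | inr j => a' j end).
split=> //; first by move=> i; case: split.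
rewrite big_split_ord mulr_sumr; congr (_ + _); apply: eq_bigr => i _.
  by rewrite (unsplitK (inl i)) mulrA.
by rewrite (unsplitK (inr i)).
Qed.

Lemma mem_ideal_gen X x : X x -> ideal_gen X x.
Proof.
move=> Xx; exists 1%N, (fun=> 1), (fun=> x); split=> //.
by rewrite big_ord1 mul1r.
Qed.

Lemma ideal_gen_min X I : is_ideal I -> X `<=` I -> ideal_gen X `<=` I.
Proof.
move=> HI XI _ [k [b [a [_ Xa ->]]]]; apply: is_ideal_sum => // i _.
by apply: is_idealMl => //; apply: XI.
Qed.

Lemma is_ideal_pow I n : is_ideal (ideal_pow I n).
Proof. exact: is_ideal_gen. Qed.

Lemma ideal_pow_sub I J n : I `<=` J -> ideal_pow I n `<=` ideal_pow J n.
Proof.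
move=> IJ; apply: ideal_gen_min; first exact: is_ideal_gen.
move=> _ [a [Ia ->]]; apply: mem_ideal_gen; exists a.
by split=> // i; apply: IJ.
Qed.

Lemma prod_mem_ideal_pow I n (a : 'I_n -> A) :
  (forall i, I (a i)) -> ideal_pow I n (\prod_(i < n) a i).
Proof. by move=> Ia; apply: mem_ideal_gen; exists a. Qed.

Lemma ideal_pow0 I x : ideal_pow I 0 x.
Proof.
rewrite -[x]mulr1; apply: is_idealMl; first exact: is_ideal_gen.
by apply: mem_ideal_gen; exists (fun=> 0); split; [case | rewrite big_ord0].
Qed.

Lemma exprn_mem_ideal_pow I n x : I x -> ideal_pow I n (x ^+ n).
Proof.
move=> Ix; rewrite -[n in x ^+ n]card_ord -prodr_const.
exact: prod_mem_ideal_pow.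
Qed.

Lemma ideal_powD_mul I m n x y :
  ideal_pow I m x -> ideal_pow I n y -> ideal_pow I (m + n) (x * y).
Proof.
have gen := is_ideal_pow I.
move=> Ix; move: x Ix y.
(* The elements [x] that work for every [y] form an ideal, so [x] may be taken to be an [m]-fold
   product; the same argument then reduces [y] to an [n]-fold product. *)
apply: (ideal_gen_min
  (I := [set x | forall y, ideal_pow I n y -> ideal_pow I (m + n) (x * y)])).
  split=> [y _|c x x' Hx Hx' y Hy] /=; first by rewrite mul0r; case: (gen (m + n)%N).
  by rewrite mulrDl -mulrA; case: (gen (m + n)%N) => _; apply; [apply: Hx | apply: Hx'].
move=> _ [a [Ia ->]] /=.
apply: (ideal_gen_min (I := [set y | ideal_pow I (m + n) (_ * y)])).
  split=> [|c y y' Hy Hy'] /=; first by rewrite mulr0; case: (gen (m + n)%N).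
  by rewrite mulrDr mulrCA; case: (gen (m + n)%N) => _; apply.
move=> _ [b [Ib ->]] /=.
pose c (i : 'I_(m + n)) := match split i with inl j => a j | inr j => b j end.
have -> : (\prod_(i < m) a i) * \prod_(i < n) b i = \prod_(i < m + n) c i.
  rewrite big_split_ord; congr (_ * _); apply: eq_bigr => i _; rewrite /c.
    by rewrite (unsplitK (inl i)).
  by rewrite (unsplitK (inr i)).
by apply: prod_mem_ideal_pow => i; rewrite /c; case: split.
Qed.

Lemma ideal_pow_leq I m n : (m <= n)%N -> ideal_pow I n `<=` ideal_pow I m.
Proof.
move=> le_mn; apply: ideal_gen_min; first exact: is_ideal_gen.
move=> _ [a [Ia ->]]; move: a Ia; rewrite -(subnKC le_mn) => a Ia.
rewrite big_split_ord /= mulrC; apply: is_idealMl; first exact: is_ideal_gen.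
exact: prod_mem_ideal_pow.
Qed.

(** Each of the [n] factors of a generator of $J^n$ absorbs one factor [s]. *)
Lemma ideal_pow_scale I J n s : (forall x, J x -> I (s * x)) ->
  forall x, ideal_pow J n x -> ideal_pow I n (s ^+ n * x).
Proof.
move=> sJI; have [g0 gD] := is_ideal_pow I n.
apply: (ideal_gen_min (I := [set y | ideal_pow I n (_ * y)])).
  split=> [|c y y' Hy Hy'] /=; first by rewrite mulr0.
  by rewrite mulrDr mulrCA; apply: gD.
move=> _ [a [Ja ->]] /=.
rewrite -[n in s ^+ n]card_ord -prodr_const -big_split /=.
by apply: prod_mem_ideal_pow => i; apply: sJI.
Qed.

Lemma prime_is_ideal p : prime_ideal p -> is_ideal p.
Proof.
case=> -[p0 _ pD] _; split; first by move: p0; rewrite in_setE.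
by move=> a x y px py; have := pD a x y; rewrite !in_setE; apply.
Qed.

Lemma prime_ideal1 p : prime_ideal p -> ~ p 1.
Proof. by case=> -[_ /negP p1 _] _ h; apply: p1; rewrite in_setE. Qed.

Lemma prime_idealM p x y : prime_ideal p -> p (x * y) -> p x \/ p y.
Proof.
case=> _ pM pxy; have := pM x y; rewrite in_setE => /(_ pxy) /orP.
by rewrite !in_setE.
Qed.

Lemma prime_ideal_prod p T (r : seq T) (P : pred T) (F : T -> A) :
  prime_ideal p -> (forall i, P i -> ~ p (F i)) -> ~ p (\prod_(i <- r | P i) F i).
Proof.
move=> pp HF; apply: (big_ind (fun x => ~ p x)) => //; first exact: prime_ideal1.
by move=> x y px py /(prime_idealM pp) [].
Qed.

Lemma prime_ideal_exp p x n : prime_ideal p -> ~ p x -> ~ p (x ^+ n).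
Proof.
by move=> pp px; rewrite -[n]card_ord -prodr_const; apply: prime_ideal_prod.
Qed.

Lemma prime_idealP p : is_ideal p -> ~ p 1 ->
  (forall x y, p (x * y) -> p x \/ p y) -> prime_ideal p.
Proof.
move=> [p0 pD] p1 pM; split; first split.
- by rewrite in_setE.
- by apply/negP; rewrite in_setE.
- by move=> a x y; rewrite !in_setE; apply: pD.
- by move=> x y; rewrite in_setE => /pM pxy; apply/orP; rewrite !in_setE.
Qed.

End IdealPowers.

(** * Ideals whose powers are read off from the $t$-adic order in $A[t]$ *)

Section Filtration.
Variables (A : idomainType) (J : set A) (Phi : {rmorphism A -> {poly A}}).
Hypothesis Phi_eval1 : forall f, (Phi f).[1] = f.
Hypothesis Phi_coef : forall f k, ideal_pow J k (Phi f)`_k.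
Hypothesis Phi_vanish : forall f, J f -> (Phi f)`_0 = 0.
Hypothesis J_ideal : is_ideal J.

(* Evaluation at [t = 1] writes [f] as the sum of the coefficients of [Phi f],
   the [k]-th of which lies in [J^k]. *)
Lemma ideal_powP n f : ideal_pow J n f <-> forall k, (k < n)%N -> (Phi f)`_k = 0.
Proof.
split; last first.
  move=> H; rewrite -(Phi_eval1 f) horner_coef.
  apply: is_ideal_sum; first exact: is_ideal_gen.
  move=> i _; rewrite expr1n mulr1; have [/H ->|le_ni] := ltnP i n.
    by case: (is_ideal_pow J n).
  exact: ideal_pow_leq le_ni _ (Phi_coef _ _).
move: f; apply: (ideal_gen_min (I := [set f | forall k, (k < n)%N -> (Phi f)`_k = 0])).
  split=> [k _|a x y Hx Hy k lt_kn] /=; first by rewrite rmorph0 coef0.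
  rewrite rmorphD rmorphM coefD coefM Hy // addr0 big1 // => i _.
  by rewrite Hx ?mulr0 // (leq_ltn_trans (leq_subr _ _)).
move=> _ [a [Ja ->]] k lt_kn; rewrite rmorph_prod.
(* Each factor is sent to a multiple of $t$, hence a product of [n] factors to a multiple of
   $t^n$. *)
have {}Ja i : exists q, Phi (a i) = q * 'X.
  have [q [r e]] : exists q r, Phi (a i) = q * 'X + r%:P.
    elim/poly_ind: (Phi (a i)) => [|p c _]; last by exists p, c.
    by exists 0, 0; rewrite mul0r addr0.
  exists q; move: (Phi_vanish (Ja i)); rewrite e coefD coefMX coefC /= add0r => ->.
  by rewrite addr0.
have [q Hq] := choice Ja.
rewrite (eq_bigr _ (fun i _ => Hq i)) big_split /= prodr_const card_ord.
by rewrite coefMXn lt_kn.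
Qed.

(** The converse of [Phi_vanish] is the case $n = 1$ of [ideal_powP]. *)
Lemma filtration_mem f : J f <-> (Phi f)`_0 = 0.
Proof.
split=> [/Phi_vanish //|H]; have : ideal_pow J 1 f by apply/ideal_powP; case.
apply: (ideal_gen_min J_ideal) => _ [a [Ja ->]]; rewrite big_ord1; exact: Ja.
Qed.

(** By [filtration_mem], [J] is the kernel of the ring morphism taking [f] to the constant
    coefficient of [Phi f], whose target [A] is a domain. *)
Lemma filtration_prime : prime_ideal J.
Proof.
apply: prime_idealP => //.
  by rewrite filtration_mem rmorph1 coef1 => /eqP; rewrite oner_eq0.
move=> x y; rewrite !filtration_mem rmorphM coef0M => /eqP.
by rewrite mulf_eq0 => /orP[] /eqP; [left | right].
Qed.

(** Since [Phi t] has a nonzero constant coefficient, multiplying by it does not raise the $t$-adic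
    order. In the induction the lower coefficients of [Phi f] already vanish, so the [k]-th
    coefficient of the product is [(Phi t)]_0 * (Phi f)[_k]. *)
Lemma filtration_primary n t f : ~ J t -> ideal_pow J n (t * f) -> ideal_pow J n f.
Proof.
rewrite filtration_mem => /eqP t0; rewrite !ideal_powP rmorphM => H k.
elim/ltn_ind: k => k IH lt_kn; move: (H k lt_kn).
rewrite coefM big_ord_recl /= subn0 big1 ?addr0 => [/eqP|i _].
  by rewrite mulf_eq0 (negPf t0) => /eqP.
rewrite IH ?mulr0 //; first by rewrite /bump /= add1n subnSK // leq_subr.
by apply: leq_ltn_trans lt_kn; apply: leq_subr.
Qed.

End Filtration.

(** * Extension of ideals to a localization, and contraction back *)

Section Localization.
Variable A : idomainType.
Implicit Types (I J p : set A).

Lemma prime_ideal_neq0 p s : prime_ideal p -> ~ p s -> s != 0.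
Proof. by move=> /prime_is_ideal [p0 _] ps; apply/eqP => s0; apply: ps; rewrite s0. Qed.

(** With a common denominator, every element of $I A_p$ is a single fraction $x/s$ with $x \in I$
    and $s \notin p$; that [s] serves as [t]. *)
Lemma loc_ideal_contract p I f : prime_ideal p -> is_ideal I ->
  loc_ideal p I (tofrac f) -> exists2 t, ~ p t & I (t * f).
Proof.
move=> pp HI [k [b [a [Hb Ia e]]]].
have : exists x s, [/\ ~ p s, I x & tofrac f = tofrac x / tofrac s].
  rewrite {}e.
  apply: (big_ind (fun z => exists x s, [/\ ~ p s, I x & z = tofrac x / tofrac s])).
  - exists 0, 1; split; [exact: prime_ideal1 | by case: HI | by rewrite tofrac0 mul0r].
  - move=> _ _ [x [s [ps Ix ->]]] [y [t [pt Iy ->]]]; exists (t * x + s * y), (s * t).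
    split; first by move=> /(prime_idealM pp) [].
      by apply: is_idealD => //; apply: is_idealMl.
    rewrite addf_div ?tofrac_eq0 ?(prime_ideal_neq0 pp) // !(tofracD, tofracM).
    by rewrite [tofrac t * _]mulrC [tofrac s * tofrac y]mulrC.
  - move=> i _; have [c [s [ps ->]]] := Hb i; have [x Ix <-] := Ia i.
    exists (c * x), s; split => //; first exact: is_idealMl.
    by rewrite tofracM mulrAC.
move=> [x [s [ps Ix ef]]]; exists s => //; suff -> : s * f = x by [].
apply/eqP; rewrite -tofrac_eq tofracM ef mulrC divfK //.
by rewrite tofrac_eq0 (prime_ideal_neq0 pp).
Qed.

Lemma mem_loc_ideal p I f : prime_ideal p -> I f -> loc_ideal p I (tofrac f).
Proof.
move=> pp If; exists 1%N, (fun=> 1), (fun=> tofrac f); split.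
- by move=> _; exists 1, 1; split; [exact: prime_ideal1 | rewrite tofrac1 divr1].
- by move=> _; exists f.
- by rewrite big_ord1 mul1r.
Qed.

(** An [s] outside [p] is a unit of $A_p$, so [a] may be replaced by [s * a] at the cost of a
    denominator. *)
Lemma loc_ideal_sub p I J : prime_ideal p ->
  (forall a, I a -> exists2 s, ~ p s & J (s * a)) ->
  loc_ideal p I `<=` loc_ideal p J.
Proof.
move=> pp IJ _ [k [b [a [Hb Ia ->]]]].
have /choice [c Hc] i : exists c : {fraction A} * {fraction A},
    [/\ localization p c.1, (@tofrac A @` J) c.2 & b i * a i = c.1 * c.2].
  have [u [s [ps ->]]] := Hb i; have [x Ix <-] := Ia i.
  have [t pt Jtx] := IJ _ Ix.
  exists (tofrac u / tofrac (s * t), tofrac (t * x)); split.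
  - by exists u, (s * t); split=> // /(prime_idealM pp) [].
  - by exists (t * x).
  - have t0 : tofrac t != 0 by rewrite tofrac_eq0 (prime_ideal_neq0 pp).
    by rewrite /= !tofracM invfM -!mulrA; do 2 congr (_ * _); rewrite mulKf.
exists k, (fun i => (c i).1), (fun i => (c i).2); split.
- by move=> i; case: (Hc i).
- by move=> i; case: (Hc i).
- by apply: eq_bigr => i _; case: (Hc i).
Qed.

End Localization.

(** * Symbolic powers of a finite intersection of primes *)

Section Bigcap.
Variables (A : idomainType) (T : finType) (J : T -> set A).
Hypothesis J_prime : forall g, prime_ideal (J g).

Let I : set A := \bigcap_(g : T) J g.

Let I_ideal : is_ideal I.
Proof.
split=> [g _|a x y Ix Iy g _]; first by case: (prime_is_ideal (J_prime g)).
by case: (prime_is_ideal (J_prime g)) => _; apply; [apply: Ix | apply: Iy].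
Qed.

(** Choose in each [J g] an element outside [p] and multiply: the product lies in every such [J g],
    and outside [p] by primality. *)
Lemma prime_avoid_bigcap (p : set A) (P : pred T) : prime_ideal p ->
  (forall g, P g -> ~ (J g `<=` p)) ->
  exists2 s, ~ p s & forall g, P g -> J g s.
Proof.
move=> pp Hp.
have /choice [s Hs] g : exists s, P g -> J g s /\ ~ p s.
  have [/Hp|] := boolP (P g); last by exists 0.
  by move=> /existsNP [s /not_implyP Hs]; exists s.
exists (\prod_(g | P g) s g).
  by apply: prime_ideal_prod => // g /Hs [].
move=> g Pg; rewrite (bigD1 g) //= mulrC; apply: is_idealMl.
  exact: prime_is_ideal.
by have [] := Hs g Pg.
Qed.

Lemma loc_symbolic_pow_bigcap n (p : set A) : prime_ideal p ->
  (forall g t f, ~ J g t -> ideal_pow (J g) n (t * f) -> ideal_pow (J g) n f) ->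
  (forall g h, J g `<=` p -> J h `<=` p -> g = h) ->
  loc_ideal p (symbolic_pow I n) = loc_ideal p (ideal_pow I n).
Proof.
move=> pp J_primary J_uniq; apply/seteqP; split; last first.
  apply: loc_ideal_sub => // f If; exists 1; first exact: prime_ideal1.
  by rewrite mul1r => q [qp _]; apply: mem_loc_ideal.
apply: loc_ideal_sub => // f symf.
have [[g gp]|none] := pselect (exists g, J g `<=` p); last first.
  have [s ps Js] : exists2 s, ~ p s & forall g, true -> J g s.
    by apply: prime_avoid_bigcap => // g _ gp; apply: none; exists g.
  exists (s ^+ n); first exact: prime_ideal_exp.
  rewrite mulrC; apply: is_idealMl; first exact: is_ideal_pow.
  by apply: exprn_mem_ideal_pow => g _; apply: Js.
have [s ps Js] : exists2 s, ~ p s & forall h, h != g -> J h s.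
  by apply: prime_avoid_bigcap => // h hg hp; rewrite (J_uniq h g) ?eqxx in hg.
have sJI x : J g x -> I (s * x).
  move=> Jx h _; have [->|hg] := eqVneq h g.
    by apply: is_idealMl => //; apply: prime_is_ideal.
  by rewrite mulrC; apply: is_idealMl; [apply: prime_is_ideal | apply: Js].
(* [J g] is the annihilator of the class of [s]: if [x * s] is in [I], it is in [J g], while [s] is
   not, because [J g] is contained in [p]. *)
have Jg_assoc : assoc_primes I (J g).
  split=> //; exists s; apply/seteqP; split=> x /=.
    by rewrite mulrC; apply: sJI.
  by move=> /(_ g Logic.I) /(prime_idealM (J_prime g)) [] // /gp.
(* Only the component of the symbolic power at [J g] is used: it gives $tf \in I^n \subseteq J_g^n$
   with $t \notin J_g$, so $f \in J_g^n$, and $s^n$ brings [f] back into $I^n$. *)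
have [t Jt Itf] := loc_ideal_contract (J_prime g) (is_ideal_pow I n) (symf _ Jg_assoc).
exists (s ^+ n); first exact: prime_ideal_exp.
apply: ideal_pow_scale sJI _ _; apply: J_primary Jt _.
by apply: ideal_pow_sub Itf => x; apply.
Qed.

End Bigcap.

(** * Induction on polynomials, and linear forms *)

Lemma mpoly_alg_ind (K : comNzRingType) n (P : {mpoly K[n]} -> Prop) :
  (forall c, P c%:MP) -> (forall i, P 'X_i) ->
  (forall f g, P f -> P g -> P (f + g)) -> (forall f g, P f -> P g -> P (f * g)) ->
  forall f, P f.
Proof.
move=> PC PX PD PM; elim/mpolyind => [|c m f _ _ Pf].
  by have := PC 0; rewrite mpolyC0.
apply: (PD) => //; rewrite -mul_mpolyC; apply: (PM) => //.
rewrite mpolyXE_id; have P1 : P 1 by have := PC 1; rewrite mpolyC1.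
apply: big_ind => // i _; elim: (m i) => [|k IH]; first by rewrite expr0.
by rewrite exprS; apply: PM.
Qed.

Lemma linear_form_sum (K : comNzRingType) n (f : {mpoly K[n]}) :
  f \is 1.-homog -> f = \sum_i f@_U_(i) *: 'X_i.
Proof.
move=> /dhomogP hf; apply/mpolyP => m; rewrite raddf_sum /=.
have [/mdeg1P [i /eqP ->]|m1] := boolP (mdeg m == 1%N).
  rewrite (bigD1 i) //= mcoeffZ mcoeffX eqxx mulr1 big1 ?addr0 // => j ji.
  by rewrite mcoeffZ mcoeffX eq_mnm1 (negPf ji) mulr0.
rewrite big1 => [|j _].
  by apply/eqP; apply: contraR m1 => fm; apply/eqP/hf; rewrite mcoeff_msupp.
rewrite mcoeffZ mcoeffX; case: eqP => [e|]; last by rewrite mulr0.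
by case/eqP: m1; rewrite -e mdeg1.
Qed.

(** * The ideal of the graph of a polynomial map *)

Section GraphIdeal.
Variables (K : fieldType) (d : nat) (l : 'I_d -> {mpoly K[d]}).

Definition graph_ideal : set {mpoly K[d + d]} :=
  ideal_gen (range (fun i => @yvar K d i - embed (l i))).

(* The substitution [x |-> x, y |-> l(x) + t (y - l(x))], contracting the space
   onto the graph of [l] as [t] goes from 1 to 0. *)
Definition graph_scaling_var (i : 'I_(d + d)) : {poly {mpoly K[d + d]}} :=
  match split i with
  | inl j => (@xvar K d j)%:P
  | inr j => (embed (l j))%:P + (@yvar K d j - embed (l j))%:P * 'X
  end.

Lemma ex_graph_scaling :
  exists Phi : {rmorphism {mpoly K[d + d]} -> {poly {mpoly K[d + d]}}},
  (forall c, Phi c%:MP = c%:MP%:P) /\ (forall i, Phi 'X_i = graph_scaling_var i).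
Proof.
exists (mmap (polyC \o @mpolyC (d + d) K) graph_scaling_var); split=> [c|i].
  exact: mmapC.
by rewrite /= mmapX mmap1U.
Qed.

(* [Phi] is kept abstract: unfolding [mmap] makes unification diverge. *)
Section Scaling.
Variable Phi : {rmorphism {mpoly K[d + d]} -> {poly {mpoly K[d + d]}}}.
Hypothesis graph_scalingC : forall c, Phi c%:MP = c%:MP%:P.
Hypothesis graph_scalingX : forall i, Phi 'X_i = graph_scaling_var i.

Lemma graph_scaling_xvar i : Phi (xvar K i) = (xvar K i)%:P.
Proof. by rewrite graph_scalingX /graph_scaling_var (unsplitK (inl i)). Qed.

Lemma graph_scaling_yvar i : Phi (yvar K i) =
  (embed (l i))%:P + (yvar K i - embed (l i))%:P * 'X.
Proof. by rewrite graph_scalingX /graph_scaling_var (unsplitK (inr i)). Qed.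

Lemma graph_scaling_embed f : Phi (embed f) = (embed f)%:P.
Proof.
elim/mpoly_alg_ind: f => [c|i|f g IHf IHg|f g IHf IHg].
- by rewrite /embed comp_mpolyC graph_scalingC.
- by rewrite /embed comp_mpolyXU -tnth_nth tnth_mktuple graph_scaling_xvar.
- by rewrite /embed comp_mpolyD rmorphD IHf IHg polyCD.
- by rewrite /embed rmorphM rmorphM IHf IHg -polyCM.
Qed.

Lemma graph_ideal_is_ideal : is_ideal graph_ideal.
Proof. exact: is_ideal_gen. Qed.

Lemma graph_ideal_gen i : graph_ideal (yvar K i - embed (l i)).
Proof. by apply: mem_ideal_gen; exists i. Qed.

Lemma graph_scaling_eval1 f : (Phi f).[1] = f.
Proof.
elim/mpoly_alg_ind: f => [c|i|f g IHf IHg|f g IHf IHg].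
- by rewrite graph_scalingC hornerC.
- rewrite graph_scalingX /graph_scaling_var -[in RHS](splitK i).
  case: split => j /=; first by rewrite hornerC.
  by rewrite hornerD hornerMX !hornerC mulr1 addrC subrK.
- by rewrite rmorphD hornerD IHf IHg.
- by rewrite rmorphM hornerM IHf IHg.
Qed.

(** The polynomials in $t$ whose [k]-th coefficient lies in $J^k$ for all [k] form a subring, the
    Rees algebra of $J$; it contains the images of the constants and of the variables. *)
Lemma graph_scaling_coef f k : ideal_pow graph_ideal k (Phi f)`_k.
Proof.
have polyCP a m : ideal_pow graph_ideal m (a%:P)`_m.
  rewrite coefC; case: m => [|m]; first exact: ideal_pow0.
  by case: (is_ideal_pow graph_ideal m.+1).
elim/mpoly_alg_ind: f k => [c|i|f g IHf IHg|f g IHf IHg] k.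
- by rewrite graph_scalingC.
- rewrite graph_scalingX /graph_scaling_var; case: split => j //.
  rewrite coefD; apply: is_idealD => //; first exact: is_ideal_pow.
  rewrite coefMX coefC; case: k => [|[|k]] /=; first exact: ideal_pow0.
    by apply: (@exprn_mem_ideal_pow _ _ 1); apply: graph_ideal_gen.
  by case: (is_ideal_pow graph_ideal k.+2).
- by rewrite rmorphD coefD; apply: is_idealD => //; apply: is_ideal_pow.
- rewrite rmorphM coefM; apply: is_ideal_sum; first exact: is_ideal_pow.
  move=> j _; have le_jk : (j <= k)%N by rewrite -ltnS.
  by rewrite -[k in ideal_pow _ k](subnKC le_jk); apply: ideal_powD_mul.
Qed.

(** The generator $y_i - l_i(x)$ is sent to $(y_i - l_i(x))t$. *)
Lemma graph_scaling_vanish f : graph_ideal f -> (Phi f)`_0 = 0.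
Proof.
move: f; apply: (ideal_gen_min (I := [set f | (Phi f)`_0 = 0])).
  split=> [|a x y Hx Hy] /=; first by rewrite rmorph0 coef0.
  by rewrite rmorphD rmorphM coefD coef0M Hx Hy mulr0 addr0.
move=> _ [i _ <-] /=.
by rewrite rmorphB graph_scaling_embed graph_scaling_yvar addrC addKr coefMX.
Qed.

End Scaling.

Lemma graph_ideal_prime : prime_ideal graph_ideal.
Proof.
have [Phi [PhiC PhiX]] := ex_graph_scaling.
exact: (filtration_prime (graph_scaling_eval1 PhiC PhiX) (graph_scaling_coef PhiC PhiX)
          (graph_scaling_vanish PhiC PhiX) graph_ideal_is_ideal).
Qed.

Lemma graph_ideal_primary n t f :
  ~ graph_ideal t -> ideal_pow graph_ideal n (t * f) -> ideal_pow graph_ideal n f.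
Proof.
have [Phi [PhiC PhiX]] := ex_graph_scaling.
exact: (filtration_primary (graph_scaling_eval1 PhiC PhiX) (graph_scaling_coef PhiC PhiX)
          (graph_scaling_vanish PhiC PhiX) graph_ideal_is_ideal).
Qed.

End GraphIdeal.

(** * Maximality of the irrelevant ideal *)

Lemma irrelevant_ideal_max (K : fieldType) d (p : set {mpoly K[d + d]}) :
  prime_ideal p -> irrelevant_ideal K d `<=` p -> p = irrelevant_ideal K d.
Proof.
move=> pp mp; apply/seteqP; split=> // f pf.
have m_ideal : is_ideal (irrelevant_ideal K d) by exact: is_ideal_gen.
(* Modulo the irrelevant ideal every polynomial is a constant. For [f] in [p] this constant lies in
   [p], so it cannot be a unit and must vanish. *)
have [c mfc] : exists c, irrelevant_ideal K d (f - c%:MP).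
  elim/mpoly_alg_ind: f {pf} => [c|i|f g [c mf] [c' mg]|f g [c mf] [c' mg]].
  - by exists c; rewrite subrr; case: m_ideal.
  - exists 0; rewrite mpolyC0 subr0 -(splitK i); apply: mem_ideal_gen.
    by case: split => j /=; [left | right]; exists j.
  - exists (c + c'); rewrite mpolyCD opprD addrACA.
    exact: is_idealD.
  - exists (c * c'); rewrite mpolyCM.
    have -> : f * g - c%:MP * c'%:MP = f * (g - c'%:MP) + c'%:MP * (f - c%:MP).
      by rewrite !mulrBr addrA [c'%:MP * f]mulrC subrK [c%:MP * _]mulrC.
    by apply: is_idealD => //; apply: is_idealMl.
have pc : p c%:MP.
  rewrite -[_%:MP](subKr f); apply: is_idealB => //; last exact: mp.
  exact: prime_is_ideal.
suff c0 : c = 0 by rewrite c0 mpolyC0 subr0 in mfc.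
apply/eqP; apply: contra_notT (prime_ideal1 pp) => c0.
rewrite -(mpolyC1 (d + d) K) -(mulVf c0) mpolyCM; apply: is_idealMl => //.
exact: prime_is_ideal.
Qed.

(** * Graphs of distinct group elements *)

Section LinearAction.
Variables (K : fieldType) (d : nat) (G : finGroupType).
Variable act : G -> {rmorphism {mpoly K[d]} -> {mpoly K[d]}}.
Hypothesis act_lin : acts_linearly act.

(** If [M] is the matrix of [k] on linear forms, a trivial fixed space makes $M - 1$ invertible, and
    [N] is its inverse. *)
Lemma fixes_only_origin_span (k : G) : fixes_only_origin act k ->
  exists N : 'M[K]_d, forall j,
    'X_j = \sum_i (N j i)%:MP * (act k 'X_i - 'X_i) :> {mpoly K[d]}.
Proof.
move=> fix0; pose M : 'M[K]_d := \matrix_(i, j) (act k 'X_i)@_U_(j).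
have actE i : act k 'X_i = \sum_j M i j *: 'X_j.
  rewrite {1}(linear_form_sum (act_linear act_lin k i)).
  by apply: eq_bigr => j _; rewrite mxE.
have inducedE u : induced_map act k u = u *m M^T.
  apply/rowP => i; rewrite !mxE actE raddf_sum /=; apply: eq_bigr => j _.
  by rewrite mevalZ mevalXU mulrC [M^T _ _]mxE.
have unitM : (M - 1%:M) \in unitmx.
  (* A row [v] of the kernel satisfies $v M^T = v$, so it is a fixed point of [induced_map] and must
     be zero. *)
  rewrite -unitmx_tr -row_free_unit -kermx_eq0; apply/eqP/row_matrixP => i.
  rewrite row0; have : [set 0] (row i (kermx (M - 1%:M)^T)); last by [].
  rewrite -fix0 /= inducedE; apply: subr0_eq.
  rewrite -{2}[row _ _]mulmx1 -mulmxBr -row_mul.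
  have -> : M^T - 1%:M = (M - 1%:M)^T by rewrite linearB /= trmx1.
  by rewrite mulmx_ker row0.
exists (invmx (M - 1%:M)) => j.
have subE i : act k 'X_i - 'X_i = \sum_m (M - 1%:M) i m *: 'X_m :> {mpoly K[d]}.
  rewrite actE -[X in _ - X](_ : \sum_m (1%:M : 'M[K]_d) i m *: 'X_m = _); last first.
    rewrite (bigD1 i) //= mxE eqxx scale1r big1 ?addr0 // => m mi.
    by rewrite mxE eq_sym (negPf mi) scale0r.
  by rewrite -sumrB; apply: eq_bigr => m _; rewrite !mxE scalerBl.
under eq_bigr => i _ do rewrite subE mul_mpolyC scaler_sumr.
(* After the exchange, the coefficient of ['X_m] is the entry [(j, m)] of $(M-1)^{-1}(M-1) = 1$. *)
rewrite exchange_big /= (bigD1 j) //= [X in _ + X]big1 ?addr0 => [|m mj].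
  under eq_bigr => i _ do rewrite scalerA.
  have := congr1 (fun B : 'M_d => B j j) (mulVmx unitM).
  by rewrite -scaler_suml mxE mxE eqxx => ->; rewrite scale1r.
under eq_bigr => i _ do rewrite scalerA.
have := congr1 (fun B : 'M_d => B j m) (mulVmx unitM).
by rewrite -scaler_suml mxE mxE eq_sym (negPf mj) => ->; rewrite scale0r.
Qed.

Let graph (g : G) := graph_ideal (fun i => act g 'X_i).

Lemma irrelevant_sub_graph_sum (g h : G) (p : set {mpoly K[d + d]}) :
  is_ideal p -> fixes_only_origin act (g^-1 * h)%g ->
  graph g `<=` p -> graph h `<=` p -> irrelevant_ideal K d `<=` p.
Proof.
move=> p_ideal /fixes_only_origin_span [N XN] gp hp.
have pgh i : p (embed (act h 'X_i - act g 'X_i)).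
  have := is_idealB p_ideal (gp _ (graph_ideal_gen _ i)) (hp _ (graph_ideal_gen _ i)).
  by rewrite /embed comp_mpolyB opprB addrC addrA subrK.
(* Apply [g] to the expression of $x_j$ through the forms $g^{-1}h(x_i) - x_i$: these become $h(x_i)
   - g(x_i)$, which lie in [p]. *)
have pg j : p (embed (act g 'X_j)).
  rewrite [in act g _]XN rmorph_sum /embed rmorph_sum; apply: is_ideal_sum => // i _.
  rewrite rmorphM rmorphM; apply: is_idealMl => //.
  by have := pgh i; rewrite rmorphB -act_mul // mulgA mulgV mul1g.
apply: ideal_gen_min => // _ [] [i _ <-].
  have -> : xvar K i = embed 'X_i.
    by rewrite /embed comp_mpolyXU -tnth_nth tnth_mktuple.
  (* Writing $x_i = g(g^{-1}(x_i))$ and expanding the linear form $g^{-1}(x_i)$ makes $x_i$ a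
     combination of the $g(x_j)$. *)
  rewrite -[in embed _](act_one act_lin 'X_i) -(mulgV g) act_mul //.
  rewrite (linear_form_sum (act_linear act_lin g^-1%g i)) rmorph_sum /embed rmorph_sum.
  apply: is_ideal_sum => // j _; rewrite -mul_mpolyC rmorphM rmorphM.
  by apply: is_idealMl => //; apply: pg.
rewrite -[yvar K i](subrK (embed (act g 'X_i))); apply: is_idealD => //.
exact/gp/graph_ideal_gen.
Qed.

End LinearAction.

Theorem theorem5 (K : fieldType) (d : nat) (G : finGroupType)
    (act : G -> {rmorphism {mpoly K[d]} -> {mpoly K[d]}})
    (hact : acts_linearly act)
    (hfix : forall g : G, g <> 1%g -> fixes_only_origin act g)
    (n : nat) (p : set {mpoly K[d + d]})
    (hp : prime_ideal p) (hpm : p <> irrelevant_ideal K d) :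
  loc_ideal p (symbolic_pow (derksen_ideal act) n) =
  loc_ideal p (ideal_pow (derksen_ideal act) n).
Proof.
apply: (loc_symbolic_pow_bigcap (J := fun g => graph_ideal (fun i => act g 'X_i))) => //.
- by move=> g; apply: graph_ideal_prime.
- by move=> g t f; apply: graph_ideal_primary.
- move=> g h gp hp'; apply: contrapT => gh; apply: hpm.
  apply: irrelevant_ideal_max => //.
  apply: (irrelevant_sub_graph_sum hact (prime_is_ideal hp) _ gp hp').
  by apply: hfix => e; apply: gh; rewrite -[h](mulKVg g) e mulg1.
Qed.
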